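(* Let $d\ge 2$ and, for $p\in[0,1]$, let $\mu(p)$ be the time constant of Bernoulli first-passage percolation on $\mathbb{Z}^d$, in which the edge passage times are i.i.d., equal to $1$ with probability $1-p$ and to $0$ with probability $p$. Then the function $p\mapsto \dfrac{\mu(p)}{1-p}$ is non-increasing on $[0,1)$, and consequently $$\mu(p_1)-\mu(p_2)\ \ge\ \frac{\mu(p_2)}{1-p_2}\,(p_2-p_1)$$ for all $0\le p_1<p_2<1$.
   Context: Consider the nearest-neighbour graph $\mathbb{Z}^d$, $d\ge 2$. For $p\in[0,1]$, let $\{t(e)\}$, indexed by the edges $e$ of $\mathbb{Z}^d$, be i.i.d. random variables with $\mathbb{P}_p(t(e)=1)=1-p$ and $\mathbb{P}_p(t(e)=0)=p$. For a finite path $\gamma=\{e_1,\dots,e_n\}$ its passage time is $T(\gamma)=\sum_{k=1}^n t(e_k)$. For vertices $u,v$, let $T(u,v)=\inf T(\gamma)$, the infimum being over all paths $\gamma$ from $u$ to $v$; for vertex sets $A,B$, let $T(A,B)=\inf_{u\in A,\,v\in B}T(u,v)$. Let $\hat e_1=(1,0,\dots,0)$, $H_n=\{u\in\mathbb{Z}^d: u_1=n\}$, $a_{0,n}=T(0,n\hat e_1)$ and $b_{0,n}=T(0,H_n)$. Let $t_{0,n}$ (respectively $s_{0,n}$) be the infimum of $T(\gamma)$ over paths $\gamma$ from $0$ to $n\hat e_1$ (respectively from $0$ to $H_n$) all of whose vertices $u$ satisfy $0\le u_1\le n$. The time constant $\mu(p)$ is the deterministic common limit $\mu(p)=\lim_{n\to\infty}\theta_{0,n}/n$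 ($\mathbb{P}_p$-almost surely) for $\theta=a,b,t,s$; in particular, $\mu(p)=\lim_{n\to\infty}a_{0,n}/n$ almost surely. By known results of Grimmett and Kesten, it is also the almost sure and $L^1$ limit of $\phi_{0,n}/n$, where $\phi_{0,n}$ is the minimal passage time over paths contained in the box $B_n=[0,n]^d\cap\mathbb{Z}^d$ from $\{0\}\times[0,n]^{d-1}$ to $\{n\}\times[0,n]^{d-1}$. *)

(* Defs.v *)
From HB Require Import structures.
From mathcomp Require Import all_boot all_order all_algebra.
From mathcomp Require Import finmap.
From mathcomp Require Import all_classical all_reals all_analysis.

Set Implicit Arguments.
Unset Strict Implicit.
Unset Printing Implicit Defensive.
Import Order.TTheory GRing.Theory Num.Theory.
Import numFieldNormedType.Exports.

Local Open Scope classical_set_scope.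
Local Open Scope ring_scope.

Definition vertex (d : nat) := 'rV[int]_d.

(* Each undirected nearest-neighbour edge {x, x + e_i} of Z^d is represented
   exactly once, by the pair (x, i). *)
Definition edge (d : nat) : choiceType := ('rV[int]_d * 'I_d)%type.

Definition joins (d : nat) (e : edge d) (u v : vertex d) : bool :=
  let x := e.1 in let y := e.1 + delta_mx 0 e.2 in
  ((u == x) && (v == y)) || ((u == y) && (v == x)).

(* Paths may revisit vertices and edges; erasing loops never increases the
   passage time when the edge times are nonnegative. *)
Fixpoint is_path (d : nat) (u : vertex d) (g : seq (edge d)) (v : vertex d)
    : Prop :=
  if g is e :: g' then exists2 w, joins e u w & is_path w g' v else u = v.

(* n times the first basis vector. *)
Definition axis_point (d n : nat) : vertex d :=
  \row_(i < d) (if val i == 0%N then n%:Z else 0).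

Section PassageTimes.
Context (R : realType) (d : nat).

Definition path_time (tau : edge d -> R) (g : seq (edge d)) : R :=
  \sum_(e <- g) tau e.

Definition passage_time (tau : edge d -> R) (u v : vertex d) : R :=
  inf [set path_time tau g | g in [set g | is_path u g v]].

Definition a0n (tau : edge d -> R) (n : nat) : R :=
  passage_time tau 0 (axis_point d n).

End PassageTimes.

Section Model.
Context (R : realType) (disp : measure_display) (Omega : measurableType disp).
Variable P : probability Omega R.

Definition mutually_independent (I : choiceType) (X : I -> {RV P >-> R})
    : Prop :=
  forall (J : {fset I}) (B : I -> set R),
    (forall i, measurable (B i)) ->
    P (\bigcap_(i in [set` J]) (X i @^-1` B i)) =
      (\prod_(i <- J) P (X i @^-1` B i))%E.

Definition iid_bernoulli_times (d : nat) (p : R) (t : edge d -> {RV P >-> R})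
    : Prop :=
  [/\ mutually_independent t,
      forall e, P [set w | t e w = 1] = (1 - p)%:E &
      forall e, P [set w | t e w = 0] = p%:E].

Definition is_time_constant (d : nat) (t : edge d -> {RV P >-> R}) (m : R)
    : Prop :=
  {ae P, forall w, (fun n : nat => a0n (fun e => t e w) n / n%:R) @ \oo --> m}.

End Model.

(* Main.v *)
Require Import Defs.
From HB Require Import structures.
From mathcomp Require Import all_boot all_order all_algebra.
From mathcomp Require Import finmap.
From mathcomp Require Import all_classical all_reals all_analysis.
From mathcomp Require Import measurable_realfun ring lra.

(** Given p1 <= p2 < 1, put q := (1 - p2) / (1 - p1), so that q is in [0, 1].
    Multiplying a field of parameter p1 (times equal to 1 with probability
    1 - p1) by an independent field whose entries are 1 with probability q and
    0 otherwise gives a field of parameter p2.  A path that is fastest for the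
    first field, of time T, keeps each of its T slow edges with probability q;
    given the first field, its mean time after this thinning is q T.  The fastest path of the thinned
    field is at least as fast, hence

      E_{p2} a_{0,n} <= q * E_{p1} a_{0,n}.

    Since a_{0,n} / n lies in [0, 1] and converges almost surely to the time
    constant, bounded convergence turns this into mu(p2) <= q mu(p1), which is
    the monotonicity of mu(p) / (1 - p); the lower bound on mu(p1) - mu(p2) is
    a rearrangement of it.

    The fields at different parameters live on unrelated probability spaces,
    so the coupling is made between laws rather than between random variables.
    It takes place on a finite set of edges, where a Bernoulli law is a finite
    weighted sum: [bern_mean_thin] is the identity of laws and
    [fastest_thin_le] the estimate for the minimum over finitely many paths.
    [integral_local_function] identifies such a weighted sum with an integral
    over the given probability space, by independence.  As there are countably
    many paths, a_{0,n} is a limit of minima over finite families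
    ([cvg_fastest]), and the estimate passes to it by bounded convergence
    ([le_integral_a0n]). *)

Set Implicit Arguments.
Unset Strict Implicit.
Unset Printing Implicit Defensive.
Import Order.TTheory GRing.Theory Num.Theory.
Import numFieldNormedType.Exports.

Local Open Scope classical_set_scope.
Local Open Scope ring_scope.

(** * Bernoulli product laws on a finite set *)

Section ProductBernoulli.
Context (R : realFieldType) (J : finType).
Implicit Types (p q : R) (s : {ffun J -> bool}) (f g : {ffun J -> bool} -> R).

(** As for passage times, [true] stands for the slow value 1, which has
    probability 1 - p. *)
Definition bern p (b : bool) : R := if b then 1 - p else p.

Definition bern_weight p s : R := \prod_j bern p (s j).

Definition bern_mean p f : R := \sum_s bern_weight p s * f s.

Lemma bern_ge0 p b : 0 <= p <= 1 -> 0 <= bern p b.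
Proof.
by case/andP=> p0 p1; rewrite /bern; case: b => //; rewrite subr_ge0.
Qed.

Lemma ler_bern_mean p f g : 0 <= p <= 1 -> (forall s, f s <= g s) ->
  bern_mean p f <= bern_mean p g.
Proof.
move=> p01 fg; apply: ler_sum => s _; apply: ler_wpM2l => //.
by apply: prodr_ge0 => j _; exact: bern_ge0.
Qed.

Lemma bern_meanZ p c f : bern_mean p (fun s => c * f s) = c * bern_mean p f.
Proof. by rewrite mulr_sumr; apply: eq_bigr => s _; rewrite mulrCA. Qed.

Lemma bern_mean_sum p (K : Type) (r : seq K) (F : K -> {ffun J -> bool} -> R) :
  bern_mean p (fun s => \sum_(k <- r) F k s) = \sum_(k <- r) bern_mean p (F k).
Proof.
rewrite exchange_big/=; apply: eq_bigr => s _.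
by rewrite mulr_sumr.
Qed.

(** The mean of a coordinate is the weight of the configurations with
    s j = true, a product event: its weight factors over the coordinates. *)
Lemma bern_mean_coord p (j : J) : bern_mean p (fun s => (s j)%:R) = 1 - p.
Proof.
pose Q i b := (i == j) ==> b.
transitivity (\sum_(s in family Q) bern_weight p s).
  rewrite [RHS]big_mkcond; apply: eq_bigr => s _.
  have -> : (s \in family Q) = s j.
    apply/familyP/idP => [/(_ j)|sj i]; rewrite !unfold_in /Q.
      by rewrite eqxx.
    by apply/implyP => /eqP->.
  by case: (s j) => /=; rewrite ?mulr1 ?mulr0.
rewrite -(bigA_distr_big_dep Q (fun _ b => bern p b)) (bigD1 j)//=.
rewrite [X in _ * X]big1 => [|i ij].
  by rewrite mulr1 big_mkcond big_bool /Q eqxx/= addr0.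
by rewrite (eq_bigl xpredT) ?big_bool/= ?subrK// => b; rewrite /Q (negbTE ij).
Qed.

(** If the coordinates of two independent fields are 1 with probabilities 1 - p
    and q, those of their product are 1 with probability (1 - p) q.  The pairs
    of configurations with a given product s form a product event, so their
    total weight factors over the coordinates and the identity reduces to that
    of a single coordinate. *)
Lemma bern_mean_thin p q f :
  bern_mean (1 - (1 - p) * q) f =
  bern_mean p (fun s => bern_mean (1 - q) (fun x => f [ffun j => s j && x j])).
Proof.
rewrite /bern_mean.
under [RHS]eq_bigr do rewrite mulr_sumr.
rewrite pair_big/=.
pose meet (sx : {ffun J -> bool} * {ffun J -> bool}) :=
  [ffun j => sx.1 j && sx.2 j].
rewrite (partition_big meet xpredT)//=; apply: eq_bigr => s _.
transitivity ((\sum_(sx | meet sx == s)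
                 bern_weight p sx.1 * bern_weight (1 - q) sx.2) * f s).
  congr (_ * _).
  pose Q j (ab : bool * bool) := (ab.1 && ab.2) == s j.
  (* one coordinate: 1 1 gives 1, the three other pairs give 0 *)
  transitivity (\prod_j \sum_(ab | Q j ab) bern p ab.1 * bern (1 - q) ab.2).
    apply: eq_bigr => j _.
    pose W a b := if Q j (a, b) then bern p a * bern (1 - q) b else 0.
    rewrite big_mkcond -(pair_big xpredT xpredT W)/= /W.
    by rewrite !big_bool/= /Q/=; case: (s j) => /=; rewrite /bern; ring.
  rewrite bigA_distr_big_dep.
  (* a field of pairs is the same as a pair of fields *)
  pose unzip (h : {ffun J -> bool * bool}) :=
    ([ffun j => (h j).1], [ffun j => (h j).2])
      : {ffun J -> bool} * {ffun J -> bool}.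
  pose zip (sx : {ffun J -> bool} * {ffun J -> bool}) :=
    [ffun j => (sx.1 j, sx.2 j)].
  rewrite (reindex zip)/=; last first.
    exists unzip => [[a b] _|h _]; rewrite /unzip /zip.
      by congr pair; apply/ffunP => j; rewrite !ffunE.
    by apply/ffunP => j; rewrite !ffunE; case: (h j).
  apply: eq_big => [sx|sx _].
    apply/familyP/eqP => [h|E j].
      by apply/ffunP => j; have := h j; rewrite !unfold_in /Q !ffunE => /eqP.
    by rewrite !unfold_in /Q -E !ffunE.
  by rewrite /bern_weight -big_split; apply: eq_bigr => j _; rewrite ffunE.
by rewrite mulr_suml; apply: eq_bigr => sx /eqP <-; rewrite mulrA.
Qed.

End ProductBernoulli.

(** * The fastest of finitely many paths *)

Section FiniteFamily.
Context (R : realType) (d : nat).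
Implicit Types (tau : edge d -> R) (g : seq (edge d)) (G : seq (seq (edge d))).

(** The default value of the minimum is the time of a path [g0], so that the
    minimum is always attained on [g0 :: G]. *)
Definition fastest g0 G tau : R :=
  \big[Num.min/path_time tau g0]_(g <- G) path_time tau g.

Lemma fastest_attained g0 G tau :
  exists2 g, g \in g0 :: G & fastest g0 G tau = path_time tau g.
Proof.
rewrite /fastest big_seq.
elim/big_ind : _ => [|x y [g gG ->] [h hG ->]|g gG].
- by exists g0 => //; rewrite mem_head.
- by case: (leP (path_time tau g) (path_time tau h)) => _; [exists g|exists h].
- by exists g => //; rewrite inE gG orbT.
Qed.

Lemma fastest_le g0 G tau g : g \in g0 :: G ->
  fastest g0 G tau <= path_time tau g.
Proof.
rewrite inE => /predU1P[->|gG]; first exact: bigmin_le_id.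
exact: ge_bigmin_seq.
Qed.

Definition extend (J : {fset edge d}) (s : {ffun J -> bool}) : edge d -> R :=
  fun e => if insub e is Some j then (s j)%:R else 0.

Lemma extend_ge0 (J : {fset edge d}) (s : {ffun J -> bool}) e : 0 <= extend s e.
Proof. by rewrite /extend; case: insub. Qed.

(** Condition on the field s of parameter p and let g be a path that is fastest
    for s.  After thinning by x, the minimum is at most the time of g, that is
    the sum of s e * x e over the edges e of g, whose mean over x is q times the
    time of g in s. *)
Lemma fastest_thin_le (J : {fset edge d}) p q g0 G :
  0 <= p <= 1 -> 0 <= q <= 1 ->
  bern_mean (1 - (1 - p) * q)
    (fun s : {ffun J -> bool} => fastest g0 G (extend s)) <=
  q * bern_mean p (fun s : {ffun J -> bool} => fastest g0 G (extend s)).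
Proof.
move=> p01 q01; rewrite bern_mean_thin -bern_meanZ; apply: ler_bern_mean => // s.
have [g gG ->] := fastest_attained g0 G (extend s).
have q'01 : 0 <= 1 - q <= 1 by lra.
pose F := fun x : {ffun J -> bool} => \sum_(e <- g) extend s e * extend x e.
have -> : q * path_time (extend s) g = bern_mean (1 - q) F.
  rewrite bern_mean_sum /path_time mulr_sumr; apply: eq_bigr => e _.
  rewrite bern_meanZ /extend; case: insubP => [j _ _|_].
    by rewrite bern_mean_coord mulrC; congr (_ * _); lra.
  by rewrite mulr0 mul0r.
apply: ler_bern_mean => // x; apply: le_trans (fastest_le _ gG) _.
apply: ler_sum => e _; rewrite /extend.
case: insub => [j|]; last by rewrite mulr0.
by rewrite ffunE; case: (s j); case: (x j); rewrite ?(mulr1,mulr0).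
Qed.

Lemma path_time_ge0 tau g : (forall e, 0 <= tau e) -> 0 <= path_time tau g.
Proof. by move=> t0; apply: sumr_ge0 => e _. Qed.

Lemma fastest_ge0 tau g0 G : (forall e, 0 <= tau e) -> 0 <= fastest g0 G tau.
Proof.
by move=> t0; have [g _ ->] := fastest_attained g0 G tau; exact: path_time_ge0.
Qed.

Definition edges_of G : {fset edge d} := seq_fset tt (flatten G).

Lemma fastest_local g0 G tau tau' :
  {in edges_of (g0 :: G), tau =1 tau'} -> fastest g0 G tau = fastest g0 G tau'.
Proof.
move=> tt; rewrite /fastest.
have E g : g \in g0 :: G -> path_time tau g = path_time tau' g.
  move=> gG; apply: eq_big_seq => e eg; apply: tt.
  by rewrite seq_fsetE; apply/flattenP; exists g.
rewrite E ?mem_head//; apply: eq_big_seq => g gG; apply: E.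
by rewrite inE gG orbT.
Qed.

End FiniteFamily.

(** * Passage times as limits of finite minima *)

Section Paths.
Context (R : realType) (d : nat).
Implicit Types (tau : edge d -> R) (u v : vertex d) (g : seq (edge d)).

(** Paths form a countable type; this is the finite list of those of code
    below [n]. *)
Definition paths_below u v (n : nat) : seq (seq (edge d)) :=
  let decode : nat -> option (seq ('rV[int]_d * 'I_d)) := choice.unpickle in
  [seq g <- pmap decode (iota 0 n) | `[< is_path u g v >]].

Lemma paths_belowP u v n g : g \in paths_below u v n -> is_path u g v.
Proof. by rewrite mem_filter => /andP[/asboolP]. Qed.

Lemma mem_paths_below u v g : is_path u g v ->
  \forall n \near \oo, g \in paths_below u v n.
Proof.
move=> ug; pose k := choice.pickle (g : seq ('rV[int]_d * 'I_d)%type).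
near=> n; rewrite mem_filter; apply/andP; split; first exact/asboolP.
rewrite mem_pmap; apply/mapP; exists k; last by rewrite choice.pickleK.
by rewrite mem_iota/= add0n; near: n; exact: nbhs_infty_gt.
Unshelve. all: by end_near. Qed.

(** A path that is fastest up to e occurs in all large enough families. *)
Lemma cvg_fastest tau u v g0 : (forall e, 0 <= tau e) -> is_path u g0 v ->
  fastest g0 (paths_below u v n) tau @[n --> \oo] --> passage_time tau u v.
Proof.
move=> t0 ug0; rewrite /passage_time; set T := [set _ | _ in _].
have T0 : has_lbound T by exists 0 => _ [g _ <-]; exact: path_time_ge0.
have Ti : has_inf T by split => //; exists (path_time tau g0), g0.
have le n : inf T <= fastest g0 (paths_below u v n) tau.
  have [g + ->] := fastest_attained g0 (paths_below u v n) tau.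
  move=> gG; apply: ge_inf => //; exists g => //.
  by move: gG; rewrite inE => /predU1P[->//|/paths_belowP].
apply/cvgrPdist_lt => e e0.
have [_ [g ug <-] ge] := inf_adherent e0 Ti.
near=> n.
rewrite distrC ger0_norm ?subr_ge0// ltrBlDl; apply: le_lt_trans ge.
apply: fastest_le; rewrite inE; apply/orP; right.
by near: n; exact: mem_paths_below.
Unshelve. all: by end_near. Qed.

Lemma passage_time_ge0 tau u v g0 : (forall e, 0 <= tau e) -> is_path u g0 v ->
  0 <= passage_time tau u v.
Proof.
move=> t0 ug0; apply: lb_le_inf; first by exists (path_time tau g0), g0.
by move=> _ [g _ <-]; exact: path_time_ge0.
Qed.

Lemma passage_time_le tau u v g0 : (forall e, 0 <= tau e) -> is_path u g0 v ->
  passage_time tau u v <= path_time tau g0.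
Proof.
move=> t0 ug0; apply: ge_inf; last by exists g0.
by exists 0 => _ [g _ <-]; exact: path_time_ge0.
Qed.

Definition axis_path (d_gt0 : (0 < d)%N) (n : nat) : seq (edge d) :=
  [seq (axis_point d k, Ordinal d_gt0) | k <- iota 0 n].

Lemma is_path_axis (d_gt0 : (0 < d)%N) n :
  is_path 0 (axis_path d_gt0 n) (axis_point d n).
Proof.
have -> : 0 = axis_point d 0 by apply/rowP => i; rewrite !mxE; case: ifP.
suff shift m : is_path (axis_point d m)
    [seq (axis_point d k, Ordinal d_gt0) | k <- iota m n]
    (axis_point d (m + n)).
  exact: shift 0%N.
elim: n m => [|n IHn] m /=; first by rewrite addn0.
exists (axis_point d m.+1); last by rewrite addnS -addSn; exact: IHn.
rewrite /joins /= eqxx /=; apply/orP; left; apply/eqP/rowP => i; rewrite !mxE/=.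
rewrite -val_eqE/=.
by case: ifP => _; rewrite ?addr0//= -addn1 PoszD.
Qed.

Lemma path_time_axis_le (d_gt0 : (0 < d)%N) n tau : (forall e, tau e <= 1) ->
  path_time tau (axis_path d_gt0 n) <= n%:R.
Proof.
move=> t1; rewrite /path_time big_map.
apply: (@le_trans _ _ (\sum_(k <- iota 0 n) 1)); first exact: ler_sum.
by rewrite big_const_seq count_predT size_iota iter_addr_0.
Qed.
End Paths.

(** * Independent Bernoulli times and functions of finitely many of them *)

Section Cylinders.
Context (R : realType) (disp : measure_display) (Omega : measurableType disp).
Context (P : probability Omega R) (d : nat) (p : R).
Context (t : edge d -> {RV P >-> R}).
Hypothesis tp : iid_bernoulli_times p t.

(** A version of the times that is 0 or 1 at every sample point. *)
Definition binary_times (w : Omega) : edge d -> R := fun e => (t e w != 0)%:R.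

Definition cylinder (J : {fset edge d}) (s : {ffun J -> bool}) : set Omega :=
  [set w | forall j : J, (t (val j) w != 0) = s j].

(** The independence hypothesis takes one event for every edge, hence the full
    set at the edges outside [J]. *)
Definition coordinate_event (J : {fset edge d}) (s : {ffun J -> bool})
    (e : edge d) : set R :=
  if insub e is Some j then if s j then ~` [set 0] else [set 0] else setT.

Lemma measurable_coordinate_event (J : {fset edge d}) (s : {ffun J -> bool}) e :
  measurable (coordinate_event s e).
Proof.
rewrite /coordinate_event; case: insub => [j|]; last exact: measurableT.
by case: (s j); [apply: measurableC|]; exact: measurable_set1.
Qed.

Lemma cylinderE (J : {fset edge d}) (s : {ffun J -> bool}) :
  cylinder s = \bigcap_(e in [set` J]) (t e @^-1` coordinate_event s e).
Proof.
rewrite /coordinate_event.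
apply/seteqP; split=> w /= h.
  move=> e /= eJ; rewrite insubT /= -h.
  by case: eqP => /=.
move=> j; have /= := h (val j) (valP j); rewrite valK.
by case: (s j) => [/eqP//|->]; rewrite eqxx.
Qed.

Lemma measurable_cylinder (J : {fset edge d}) (s : {ffun J -> bool}) :
  measurable (cylinder s).
Proof.
rewrite cylinderE; apply: fin_bigcap_measurable => [|e _].
  exact: finite_fset.
rewrite -[_ @^-1` _]setTI; apply: measurable_funPT => //.
exact: measurable_coordinate_event.
Qed.

Lemma probability_cylinder (J : {fset edge d}) (s : {ffun J -> bool}) :
  P (cylinder s) = (bern_weight p s)%:E.
Proof.
case: tp => indep _ t0.
rewrite cylinderE indep ; last exact: measurable_coordinate_event.
rewrite big_seq_fsetE/= /bern_weight -prodEFin; apply: eq_bigr => j _.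
rewrite /coordinate_event valK /bern; case: (s j); last exact: t0.
rewrite -preimage_setC probability_setC ?EFinB ?t0//.
Qed.

(** A function of the times on the finite set [J] is constant on each cylinder
    over [J], so it is simple and its integral is a weighted sum over the
    configurations on [J]. *)
Section LocalFunctions.
Context (J : {fset edge d}) (f : (edge d -> R) -> R).
Hypothesis f_local : forall tau tau', {in J, tau =1 tau'} -> f tau = f tau'.

Lemma local_functionE w :
  f (binary_times w) =
  \sum_(s : {ffun J -> bool}) f (extend R s) * \1_(cylinder s) w.
Proof.
pose s0 := [ffun j : J => t (val j) w != 0].
rewrite (bigD1 s0)//= big1 ?addr0 => [|s ss0].
  rewrite indicE mem_set ?mulr1 => [|j]; last by rewrite ffunE.
  by apply: f_local => e eJ; rewrite /extend insubT ffunE.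
rewrite indicE memNset ?mulr0// => sw.
by move/eqP: ss0; apply; apply/ffunP => j; rewrite ffunE sw.
Qed.

Lemma measurable_local_function : measurable_fun setT (f \o binary_times).
Proof.
rewrite (_ : _ \o _ = fun w =>
    \sum_(s : {ffun J -> bool}) f (extend R s) * \1_(cylinder s) w).
  apply: measurable_sum => s; apply: measurable_funM => //.
  by apply: measurable_indic; exact: measurable_cylinder.
by apply/funext => w; exact: local_functionE.
Qed.

Lemma integral_local_function :
  (forall s : {ffun J -> bool}, 0 <= f (extend R s)) ->
  (\int[P]_w (f (binary_times w))%:E =
   (bern_mean p (fun s : {ffun J -> bool} => f (extend R s)))%:E)%E.
Proof.
move=> f0.
transitivity (\int[P]_w (\sum_(s : {ffun J -> bool})
    (f (extend R s))%:E * (\1_(cylinder s) w)%:E))%E.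
  by apply: eq_integral => w _; rewrite local_functionE -sumEFin.
rewrite ge0_integral_sum//=; last first.
- by move=> s w _; rewrite mule_ge0 ?lee_fin.
- move=> s; apply: measurable_funeM; apply/measurable_EFinP.
  by apply: measurable_indic; exact: measurable_cylinder.
rewrite /bern_mean -sumEFin; apply: eq_bigr => s _.
rewrite ge0_integralZl_EFin//=; last first.
- by apply/measurable_EFinP/measurable_indic; exact: measurable_cylinder.
rewrite integral_indic ?setIT; [|exact: measurableT|exact: measurable_cylinder].
by rewrite EFinM -probability_cylinder muleC.
Qed.
End LocalFunctions.

(** Each time is 0 or 1 with probability p + (1 - p) = 1, and there are
    countably many edges. *)
Lemma binary_times_ae : {ae P, forall w, t ^~ w = binary_times w}.
Proof.
case: tp => _ t1 t0.
have E e : {ae P, forall w, t e w = binary_times w e}.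
  have m (x : R) : measurable [set w | t e w = x].
    rewrite -[X in measurable X]setTI.
    exact: (measurable_funPT (t e) measurableT [set x] (measurable_set1 x)).
  exists (~` ([set w | t e w = 1] `|` [set w | t e w = 0])); split.
  - by apply: measurableC; apply: measurableU.
  - rewrite probability_setC; last exact: measurableU.
    rewrite measureU//; last first.
      by apply/seteqP; split => w //= [-> /eqP]; rewrite oner_eq0.
    transitivity (1 - ((1 - p)%:E + p%:E))%E; last by rewrite -EFinD subrK subrr.
    by congr (1 - (_ + _))%E; [exact: t1|exact: t0].
  - move=> w /= te [] tw; apply: te; rewrite /binary_times tw.
      by rewrite oner_eq0.
    by rewrite eqxx.
have : {ae P, forall w, forall n : nat, forall e, 
    choice.unpickle n = Some (e : 'rV[int]_d * 'I_d)%type ->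
    t e w = binary_times w e}.
  apply: ae_foralln => n.
  case: (choice.unpickle n) => [e|]; last by apply/aeW => w e.
  by apply: filterS (E e) => w h _ [<-].
apply: filterS => w h; apply/funext => e.
apply: (h (choice.pickle (e : 'rV[int]_d * 'I_d)%type)).
exact: choice.pickleK.
Qed.
End Cylinders.

(** * Mean passage times along the axis *)

Section Mean.
Context (R : realType) (disp : measure_display) (Omega : measurableType disp).
Context (P : probability Omega R) (d : nat) (p : R).
Context (t : edge d -> {RV P >-> R}).
Hypothesis d_gt0 : (0 < d)%N.
Hypothesis tp : iid_bernoulli_times p t.

Local Notation X := (binary_times t).

Lemma binary_times_ge0 w e : 0 <= X w e.
Proof. by rewrite /binary_times. Qed.

Lemma binary_times_le1 w e : X w e <= 1.
Proof. by rewrite /binary_times; case: (_ != _). Qed.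

Lemma measurable_fastest g0 (G : seq (seq (edge d))) :
  measurable_fun setT (fun w => fastest g0 G (X w)).
Proof. exact: (measurable_local_function t (@fastest_local R d g0 G)). Qed.

Lemma integral_fastest g0 (G : seq (seq (edge d))) :
  (\int[P]_w (fastest g0 G (X w))%:E =
   (bern_mean p (fun s : {ffun edges_of (g0 :: G) -> bool} =>
      fastest g0 G (extend R s)))%:E)%E.
Proof.
apply: (integral_local_function tp (@fastest_local R d g0 G)) => s.
by apply: fastest_ge0 => e; exact: extend_ge0.
Qed.

Lemma cvg_fastest_a0n n w :
  fastest (axis_path d_gt0 n) (paths_below 0 (axis_point d n) L) (X w)
    @[L --> \oo] --> a0n (X w) n.
Proof.
by apply: cvg_fastest; [exact: binary_times_ge0|exact: is_path_axis].
Qed.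

Lemma measurable_a0n n : measurable_fun setT (fun w => a0n (X w) n).
Proof.
apply: measurable_fun_cvg => [L|w _]; last exact: cvg_fastest_a0n.
exact: measurable_fastest.
Qed.

Lemma a0n_ge0 n w : 0 <= a0n (X w) n.
Proof.
apply: (passage_time_ge0 (binary_times_ge0 w)).
exact: (is_path_axis d_gt0 n).
Qed.

Lemma a0n_le n w : a0n (X w) n <= n%:R.
Proof.
apply: le_trans (path_time_axis_le d_gt0 n (binary_times_le1 w)).
by apply: (passage_time_le (binary_times_ge0 w)); exact: is_path_axis.
Qed.

(** The minima are bounded by n, the number of edges of the axis path. *)
Lemma cvg_integral_fastest n :
  (\int[P]_w (fastest (axis_path d_gt0 n)
                (paths_below 0 (axis_point d n) L) (X w))%:E
    @[L --> \oo] --> \int[P]_w (a0n (X w) n)%:E)%E.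
Proof.
apply: (@dominated_cvg _ _ _ P setT measurableT _ _ (EFin \o cst n%:R)) => //.
- by move=> L; apply/measurable_EFinP; exact: measurable_fastest.
- by move=> w _; apply: cvg_EFin; [exact: nearW|exact: cvg_fastest_a0n].
- exact: finite_measure_integrable_cst.
- move=> L w _ /=; rewrite lee_fin ger0_norm.
    apply: le_trans (path_time_axis_le d_gt0 n (binary_times_le1 w)).
    by apply: fastest_le; rewrite mem_head.
  by apply: fastest_ge0; exact: binary_times_ge0.
Qed.

(** Bounded convergence, as 0 <= a_{0,n} / n <= 1. *)
Lemma cvg_integral_a0n_div m : is_time_constant t m ->
  (\int[P]_w (a0n (X w) n / n%:R)%:E @[n --> \oo] --> m%:E)%E.
Proof.
move=> tm.
have -> : m%:E = (\int[P]_w (cst m%:E w))%E.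
  by rewrite integral_cst// [X in (_ * X)%E]probability_setT mule1.
have [||||//] := @dominated_convergence _ _ _ P setT measurableT
  (fun n w => (a0n (X w) n / n%:R)%:E) (cst m%:E) (EFin \o cst 1) _ _ _
  (finite_measure_integrable_cst P 1 measurableT).
- move=> n; apply/measurable_EFinP.
  exact: (measurable_funM (measurable_a0n n) (measurable_cst _)).
- exact: measurable_cst.
- have := binary_times_ae tp; move: tm; apply: filterS2 => w lim E _.
  by apply: cvg_EFin; [exact: nearW|rewrite -E].
- apply/aeW => w n _ /=; rewrite lee_fin ger0_norm ?divr_ge0 ?a0n_ge0//.
  case: n => [|n]; first by rewrite invr0 mulr0.
  by rewrite ler_pdivrMr ?ltr0n// mul1r a0n_le.
Qed.
End Mean.

(** * Comparison of two parameters *)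

(** Only the laws of the two fields are compared, so the probability spaces are
    arbitrary. *)
Section Thinning.
Context (R : realType) (d : nat) (p1 p2 q : R).
Context (disp1 : measure_display) (Omega1 : measurableType disp1).
Context (disp2 : measure_display) (Omega2 : measurableType disp2).
Context (P1 : probability Omega1 R) (P2 : probability Omega2 R).
Context (t1 : edge d -> {RV P1 >-> R}) (t2 : edge d -> {RV P2 >-> R}).
Hypothesis d_gt0 : (0 < d)%N.
Hypothesis p1P : 0 <= p1 <= 1.
Hypothesis qP : 0 <= q <= 1.
Hypothesis p2E : 1 - p2 = (1 - p1) * q.
Hypothesis t1P : iid_bernoulli_times p1 t1.
Hypothesis t2P : iid_bernoulli_times p2 t2.

Lemma le_integral_a0n n :
  (\int[P2]_w (a0n (binary_times t2 w) n)%:E <=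
   q%:E * \int[P1]_w (a0n (binary_times t1 w) n)%:E)%E.
Proof.
have lim1 := @cvg_integral_fastest _ _ _ P1 _ t1 d_gt0 n.
have lim2 := @cvg_integral_fastest _ _ _ P2 _ t2 d_gt0 n.
apply: (lee_cvg_to lim2 (cvgeZl _ lim1)) => //.
apply: nearW => L; rewrite (integral_fastest t1P) (integral_fastest t2P).
rewrite -EFinM lee_fin; have -> : p2 = 1 - (1 - p1) * q by rewrite -p2E subKr.
exact: fastest_thin_le.
Qed.

Lemma time_constant_thin_le m1 m2 :
  is_time_constant t1 m1 -> is_time_constant t2 m2 -> m2 <= q * m1.
Proof.
move=> h1 h2; rewrite -lee_fin EFinM.
have lim1 := @cvg_integral_a0n_div _ _ _ P1 _ _ t1 d_gt0 t1P _ h1.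
have lim2 := @cvg_integral_a0n_div _ _ _ P2 _ _ t2 d_gt0 t2P _ h2.
apply: (lee_cvg_to lim2 (cvgeZl _ lim1)) => //.
apply: nearW => n.
have pull dd (O : measurableType dd) (Q : probability O R)
    (t : edge d -> {RV Q >-> R}) :
  (\int[Q]_w (a0n (binary_times t w) n / n%:R)%:E =
   n%:R^-1%:E * \int[Q]_w (a0n (binary_times t w) n)%:E)%E.
  rewrite -ge0_integralZl_EFin//.
  - by apply: eq_integral => w _; rewrite -EFinM mulrC.
  - by move=> w _; rewrite lee_fin a0n_ge0.
  - by apply/measurable_EFinP; exact: measurable_a0n.
rewrite !pull muleCA; apply: lee_wpmul2l; first by rewrite lee_fin.
exact: le_integral_a0n.
Qed.
End Thinning.

Theorem theorem1p2 (R : realType) (d : nat) (hd : (2 <= d)%N)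
    (disp : R -> measure_display)
    (Omega : forall p : R, measurableType (disp p))
    (P : forall p : R, probability (Omega p) R)
    (t : forall p : R, edge d -> {RV (P p) >-> R})
    (mu : R -> R)
    (ht : forall p : R, 0 <= p <= 1 -> iid_bernoulli_times p (t p))
    (hmu : forall p : R, 0 <= p <= 1 -> is_time_constant (t p) (mu p)) :
  {in `[0, 1[ &, {homo (fun p : R => mu p / (1 - p)) : p q /~ p <= q}} /\
  (forall p1 p2 : R, 0 <= p1 -> p1 < p2 -> p2 < 1 ->
     mu p1 - mu p2 >= mu p2 / (1 - p2) * (p2 - p1)).
Proof.
have mono p1 p2 : 0 <= p1 -> p1 <= p2 -> p2 < 1 ->
    mu p2 / (1 - p2) <= mu p1 / (1 - p1).
  move=> p10 p12 p21.
  have h1 : 0 <= p1 <= 1 by lra.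
  have h2 : 0 <= p2 <= 1 by lra.
  have c1 : 0 < 1 - p1 by lra.
  have c2 : 0 < 1 - p2 by lra.
  pose q := (1 - p2) / (1 - p1).
  have q01 : 0 <= q <= 1.
    by apply/andP; split; [apply: divr_ge0; lra|rewrite ler_pdivrMr//; lra].
  have p2E : 1 - p2 = (1 - p1) * q by rewrite /q mulrCA divff ?mulr1// gt_eqF.
  rewrite ler_pdivrMr// mulrAC -mulrA [leRHS]mulrC.
  exact: (time_constant_thin_le (ltnW hd) h1 q01 p2E
    (ht _ h1) (ht _ h2) (hmu _ h1) (hmu _ h2)).
split=> [p q|p1 p2 p10 p12 p21].
  rewrite !in_itv/= => /andP[p0 p1] /andP[q0 q1] qp.
  exact: mono.
have := mono _ _ p10 (ltW p12) p21.
have c1 : 0 < 1 - p1 by lra.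
have c2 : 0 < 1 - p2 by lra.
rewrite ler_pdivlMr// => le.
have -> : p2 - p1 = (1 - p1) - (1 - p2) by lra.
by rewrite mulrBr divfK ?gt_eqF//; lra.
Qed.
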